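(* (1) The class of monoids with regular cross-sections is not closed under taking direct factors. (2) The class of Markov monoids is not closed under taking direct factors.
   Context: A cross-section for a monoid $M$ is a language $L\subseteq A^*$ over some generating set $A$ for $M$ (elements of $A$ being viewed as letters; for regular languages $A$ is finite) such that every element of $M$ is represented by exactly one word in $L$. It is regular if $L$ is a regular language. A Markov monoid is a monoid that has a prefix-closed regular cross-section over some (necessarily finite) generating set, where prefix-closed means that every prefix of every word in $L$ lies in $L$. A class of monoids is closed under taking direct factors if, whenever $M$ and $N$ are monoids such that the direct product $M\times N$ belongs to the class, both $M$ and $N$ belong to the class. *)

(* Defs.v *)
From HB Require Import structures.
From mathcomp Require Import all_boot finmap.

Set Implicit Arguments.
Unset Strict Implicit.
Unset Printing Implicit Defensive.

Definition language (A : Type) := seq A -> Prop.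

Record dfa (A : finType) := Dfa {
  dfa_state : finType;
  dfa_start : dfa_state;
  dfa_final : pred dfa_state;
  dfa_step : dfa_state -> A -> dfa_state }.

Definition dfa_accept (A : finType) (D : dfa A) (w : seq A) : bool :=
  dfa_final (foldl (@dfa_step A D) (dfa_start D) w).

Definition regular (A : finType) (L : language A) : Prop :=
  exists D : dfa A, forall w : seq A, L w <-> dfa_accept D w.

Definition prefix_closed (A : eqType) (L : language A) : Prop :=
  forall u w : seq A, prefix u w -> L w -> L u.

(* A finite set A of elements of M coerces to the finite type of its elements,
   so that A serves as an alphabet; word_value maps a word to the element of M
   that it represents. *)
Definition word_value (M : monoidType) (A : {fset M}) (w : seq A) : M :=
  (\prod_(a <- w) val a)%g.

Definition generating (M : monoidType) (A : {fset M}) : Prop :=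
  forall x : M, exists w : seq A, word_value w = x.

Definition cross_section (M : monoidType) (A : {fset M}) (L : language A) :
    Prop :=
  forall x : M, exists! w : seq A, L w /\ word_value w = x.

Definition has_regular_cross_section (M : monoidType) : Prop :=
  exists (A : {fset M}) (L : language A),
    [/\ generating A, regular L & cross_section L].

Definition Markov_monoid (M : monoidType) : Prop :=
  exists (A : {fset M}) (L : language A),
    [/\ generating A, prefix_closed L, regular L & cross_section L].

(* The product M * N carries the componentwise monoid structure. *)
Definition closed_under_direct_factors (C : monoidType -> Prop) : Prop :=
  forall M N : monoidType, C (M * N)%type -> C M /\ C N.

(* Main.v *)
(* Let the free monoid on a, b, $ act on the left of the set of points P i j and
   Q k so that P i j = a^i b^j (P 0 0) and $ (P i j) = Q (min i j), with b
   sending P i.+1 j to Q 0 and each Q k fixed; let M be the union of the free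
   monoid and the set of points, the points being left zeros.

   M x Z has a prefix-closed regular cross-section: give a, b, $ the weights 1,
   -1, 0.  The elements with second component n over the free monoid and over
   the P i j are represented by words followed by a power of a generator of Z,
   while those over the Q k are represented by the words $ a^i b^j (P 0 0),
   because (i, j) |-> (min i j, i - j) is a bijection from N^2 to N x Z.

   M itself has no regular cross-section: pumping a long enough representative
   of some Q k replaces i or j by an arithmetic progression (or makes the value
   constant), and min i j then stabilises, so that two words have the same
   value. *)

Require Import Defs.
From HB Require Import structures.
From mathcomp Require Import all_boot ssralg ssrint finmap zify.

Set Implicit Arguments.
Unset Strict Implicit.
Unset Printing Implicit Defensive.

Import GRing.Theory.

(** * Cross-sections over abstract alphabets *)

Lemma Markov_regular_cross_section (M : monoidType) :
  Markov_monoid M -> has_regular_cross_section M.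
Proof. by case=> A [L [genA _ regL crossL]]; exists A, L. Qed.

(** Injectivity of [g] makes words over [X] correspond to words over the finite set of its values,
    so a convenient finite type can serve as alphabet. *)
Lemma Markov_of_letters (M : monoidType) (X : finType) (g : X -> M)
    (L : language X) :
  injective g -> prefix_closed L -> regular L ->
  (forall x : M, exists! w : seq X, L w /\ (\prod_(a <- w) g a)%g = x) ->
  Markov_monoid M.
Proof.
move=> g_inj pfL [D DL] csL; pose A := [fset g x | x in X]%fset.
have gA x : g x \in A by apply/imfsetP; exists x.
pose f x : A := [` gA x]%fset.
have surj (a : A) : exists x, f x == a.
  by have /imfsetP[x _ e] := valP a; exists x; apply/eqP/val_inj; rewrite e.
pose h a := xchoose (surj a).
have hK : cancel h f by move=> a; exact/eqP/(xchooseP (surj a)).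
have fK : cancel f h.
  by move=> x; apply: g_inj; have /(congr1 val) := hK (f x).
have mhK := mapK hK; have mfK := mapK fK.
have valh (w : seq A) : word_value w = (\prod_(a <- map h w) g a)%g.
  by rewrite /word_value big_map; apply: eq_bigr => a _; rewrite -{1}(hK a).
exists A, (fun w => L (map h w)); split.
- move=> x; have [w [[_ wx] _]] := csL x.
  by exists (map f w); rewrite valh mfK.
- move=> u w; case/prefixP=> v -> /=; rewrite map_cat => Lw.
  exact: pfL (prefix_prefix _ _) Lw.
- exists (Dfa (dfa_start D) (@dfa_final _ D)
    (fun s a => dfa_step (d:=D) s (h a))).
  move=> w; rewrite DL /dfa_accept /=.
  suff -> : forall s, foldl (@dfa_step X D) s (map h w) =
    foldl (fun s a => dfa_step (d:=D) s (h a)) s w by [].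
  by elim: w => //= a w IH s; rewrite IH.
- move=> x; have [w [[Lw wx] uw]] := csL x.
  exists (map f w); split; first by rewrite valh mfK.
  by move=> v [Lv vx]; rewrite (uw (map h v)) ?mhK // -valh.
Qed.

(** * Partial automata and pumping *)

Definition prun (S A : Type) (step : S -> A -> option S) (s : S) (w : seq A) :
    option S :=
  foldl (fun o a => obind (step^~ a) o) (Some s) w.

Lemma prun_cat (S A : Type) (step : S -> A -> option S) s u v :
  prun step s (u ++ v) = obind (fun t => prun step t v) (prun step s u).
Proof.
rewrite /prun foldl_cat; case: (foldl _ _ u) => //=.
by elim: v.
Qed.

Lemma prun_cons (S A : Type) (step : S -> A -> option S) s a w :
  prun step s (a :: w) = obind (fun t => prun step t w) (step s a).
Proof. exact: (prun_cat _ _ [:: a]). Qed.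

Lemma prun_rcons (S A : Type) (step : S -> A -> option S) s u a :
  prun step s (rcons u a) = obind (step^~ a) (prun step s u).
Proof. by rewrite /prun foldl_rcons. Qed.

(** A run that has reached [None] stays there, and every other state is final. *)
Lemma prun_prefix_closed (S : Type) (A : eqType) (step : S -> A -> option S) s :
  prefix_closed (fun w : seq A => prun step s w).
Proof.
by move=> u w /prefixP[v ->]; rewrite prun_cat; case: (prun step s u).
Qed.

Lemma prun_regular (S A : finType) (step : S -> A -> option S) s :
  regular (fun w : seq A => prun step s w).
Proof.
by exists (Dfa (Some s) (fun o => isSome o) (fun o a => obind (step^~ a) o)).
Qed.

(** Two of the [size w + 1] prefixes lead to the same state; the factor [y] between them labels a
    loop. *)
Lemma dfa_pump (A : finType) (D : dfa A) (w : seq A) :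
  #|dfa_state D| <= size w ->
  exists x y z, [/\ w = x ++ y ++ z, y <> [::] & forall n,
    dfa_accept D (x ++ flatten (nseq n y) ++ z) = dfa_accept D w].
Proof.
move=> le_w; pose st i := foldl (@dfa_step A D) (dfa_start D) (take i w).
have /injectivePn[i [j ij e]] : ~~ injectiveb (fun i : 'I_(size w).+1 => st i).
  apply/negP=> /injectiveP/leq_card; rewrite card_ord; lia.
wlog lt_ij : i j ij e / i < j.
  move=> H; case: (ltngtP i j) => [|?|/val_inj ee]; first exact: H.
    by apply: (H j i); rewrite // eq_sym.
  by rewrite ee eqxx in ij.
have ltj := ltn_ord j.
pose y := drop i (take j w).
have ey : foldl (@dfa_step A D) (st i) y = st i.
  rewrite {2}e /st -{1}(cat_take_drop i (take j w)) foldl_cat take_takel //.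
  exact: ltnW.
have ew : w = take i w ++ y ++ drop j w.
  rewrite catA /y -{1}(cat_take_drop j w); congr cat.
  by rewrite -{1}(cat_take_drop i (take j w)) take_takel // ltnW.
exists (take i w), y, (drop j w); split=> //.
  by move/(congr1 size); rewrite /y size_drop size_takel /=; lia.
move=> n; rewrite [in RHS]ew /dfa_accept !foldl_cat -/(st i) ey.
by congr (dfa_final (foldl _ _ _)); elim: n => //= n IH; rewrite foldl_cat ey.
Qed.

(** Only finitely many words over [A] have bounded length. *)
Lemma long_image (A : finType) (n : nat) (f : nat -> seq A) :
  injective f -> exists k, n <= size (f k).
Proof.
move=> f_inj; pose N := #|{: n.-bseq A}|.
have [/existsP[k lt_k]|/existsPn short] :=
  boolP [exists k : 'I_N.+1, n <= size (f k)]; first by exists k.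
have le k : size (f (k : 'I_N.+1)) <= n by rewrite ltnW // ltnNge short.
have /leq_card : injective (fun k => Bseq (le k)).
  by move=> k l [/f_inj/val_inj].
by rewrite card_ord ltnn.
Qed.

(** * The monoid of words and points *)

Inductive letter := La | Lb | Ld.

Definition letter_encode (y : letter) : option bool :=
  match y with La => Some true | Lb => Some false | Ld => None end.
Definition letter_decode (o : option bool) : letter :=
  match o with Some true => La | Some false => Lb | None => Ld end.
Lemma letter_encodeK : cancel letter_encode letter_decode.
Proof. by case. Qed.
HB.instance Definition _ := Finite.copy letter (can_type letter_encodeK).

Definition point := (nat * nat + nat)%type.
Definition P i j : point := inl (i, j).
Definition Q k : point := inr k.

Definition act (y : letter) (s : point) : point :=
  match s with
  | inl (i, j) =>
    match y with
    | La => P i.+1 j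
    | Lb => if i is 0 then P 0 j.+1 else Q 0
    | Ld => Q (minn i j)
    end
  | inr k => Q k
  end.
Definition acts (u : seq letter) (s : point) : point := foldr act s u.

Definition minmon := (seq letter + point)%type.
HB.instance Definition _ := Choice.on minmon.

Definition minmon_one : minmon := inl [::].
Definition minmon_mul (x y : minmon) : minmon :=
  match x, y with
  | inl u, inl v => inl (u ++ v)
  | inl u, inr s => inr (acts u s)
  | inr s, _ => inr s
  end.
Lemma minmon_mulA : associative minmon_mul.
Proof.
case=> [u|s] // [v|t] [w|r] //=; first by rewrite catA.
by rewrite /acts foldr_cat.
Qed.
Lemma minmon_mul1 : left_id minmon_one minmon_mul.
Proof. by case. Qed.
Lemma minmon_mulr1 : right_id minmon_one minmon_mul.
Proof. by case=> //= u; rewrite cats0. Qed.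
HB.instance Definition _ :=
  isMonoid.Build minmon minmon_mulA minmon_mul1 minmon_mulr1.

Lemma acts_Q u k : acts u (Q k) = Q k.
Proof. by elim: u => //= y u ->. Qed.

Lemma acts_cat u v s : acts (u ++ v) s = acts u (acts v s).
Proof. exact: foldr_cat. Qed.

Lemma acts_nseq_a p i j : acts (nseq p La) (P i j) = P (p + i) j.
Proof. by elim: p => //= p ->. Qed.

Lemma acts_nseq_b q j : acts (nseq q Lb) (P 0 j) = P 0 (q + j).
Proof. by elim: q => //= q ->. Qed.

Lemma acts_nseq_bS q i j : acts (nseq q.+1 Lb) (P i.+1 j) = Q 0.
Proof. by elim: q => //= q ->. Qed.

(** No letter leaves the points [Q k]. Hence [Ld] cannot occur in [u], and [Lb] can act only while
    the first coordinate is 0, before any [La]. *)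
Lemma acts_eqP u i j i' j' : acts u (P i j) = P i' j' ->
  exists p q, [/\ u = nseq p La ++ nseq q Lb, i' = i + p, j' = j + q
    & (q == 0) || (i == 0)].
Proof.
elim: u i' j' => [|y u IH] i' j' /=.
  by case=> <- <-; exists 0, 0; rewrite !addn0.
case: (acts u _) IH => [[i1 j1]|k] //= /(_ _ _ erefl) [p [q [-> -> -> h]]].
case: y => //=.
  by case=> <- <-; exists p.+1, q; rewrite addnS.
case e: (i + p) => // -[<- <-]; have [i0 p0] : i = 0 /\ p = 0 by lia.
by exists 0, q.+1; rewrite i0 p0 addnS.
Qed.

(** * Sequences of points under iteration *)

Definition stationary (T : Type) (f : nat -> T) :=
  exists N, forall n, N <= n -> f n = f N.

(* The shapes that [n |-> v u^n s] can take: no other one occurs because an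
   [Lb] acting after an [La] leads to [Q 0]. *)
Definition tame (f : nat -> point) :=
  [\/ exists l r j, 0 < l /\ forall n, 0 < n -> f n = P (n * l + r) j,
      exists i l r, 0 < l /\ forall n, 0 < n -> f n = P i (n * l + r)
    | stationary f].

Lemma stationary_from (T : Type) (f : nat -> T) N t :
  (forall n, N <= n -> f n = t) -> stationary f.
Proof. by move=> fN; exists N => n le_n; rewrite !fN. Qed.

Lemma tame_act y f : tame f -> tame (fun n => act y (f n)).
Proof.
case=> [[l [r [j [l0 fE]]]]|[i [l [r [l0 fE]]]]|[N fE]].
- case: y.
  + by apply: Or31; exists l, r.+1, j; split=> // n n0; rewrite fE //= addnS.
  + apply/Or33/(@stationary_from _ _ 1 (Q 0)) => n n0; rewrite fE //=.
    by case e: (_ + _) => //; nia.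
  (* For [n > j] the growing coordinate exceeds [j], so the minimum is [j]; the bound [j.+1] also
     gives the [0 < n] required by [fE]. *)
  + apply/Or33/(@stationary_from _ _ j.+1 (Q j)) => n n0.
    by rewrite fE /=; [congr Q; nia | lia].
- case: y.
  + by apply: Or32; exists i.+1, l, r; split=> // n n0; rewrite fE.
  + case: i fE => [|i] fE.
      by apply: Or32; exists 0, l, r.+1; split=> // n n0; rewrite fE //= addnS.
    by apply/Or33/(@stationary_from _ _ 1 (Q 0)) => n n0; rewrite fE.
  + apply/Or33/(@stationary_from _ _ i.+1 (Q i)) => n n0.
    by rewrite fE /=; [congr Q; nia | lia].
- by apply: Or33; exists N => n /fE ->.
Qed.

Lemma tame_acts u f : tame f -> tame (fun n => acts u (f n)).
Proof. by move=> tf; elim: u => //= y u; apply: tame_act. Qed.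

(** Once some [Q k] is reached the sequence is constant. Otherwise [u] is a power of [La] followed
    by a power of [Lb], and the cases are which of these are empty. *)
Lemma tame_iter u s : tame (fun n => iter n (acts u) s).
Proof.
have stQ N k : iter N (acts u) s = Q k -> tame (fun n => iter n (acts u) s).
  move=> e; apply/Or33/(@stationary_from _ _ N (Q k)) => n /subnK <-.
  by rewrite iterD e; elim: (n - N) => //= m ->; exact: acts_Q.
case: s stQ => [[i j]|k] stQ; last exact: (stQ 0 k).
case e1: (acts u (inl (i, j))) => [[i' j']|k]; last exact: (stQ 1 k).
have [[|p] [[|q] [eu ei ej h]]] := acts_eqP e1.
- by apply: Or33; exists 0 => n _; elim: n => //= n ->; rewrite eu.
- have i0 : i = 0 by move: h => /=; lia.
  apply: Or32; exists 0, q.+1, j; split=> // n _.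
  elim: n => [|n /= ->]; first by rewrite i0.
  by rewrite eu acts_nseq_b mulSn addnA.
- apply: Or31; exists p.+1, i, j; split=> // n _.
  elim: n => [|n /= ->] //.
  by rewrite eu cats0 acts_nseq_a mulSn addnA.
(* The first application makes the first coordinate positive, so in the second one the [Lb]s lead to
   [Q 0]. *)
- apply: (stQ 2 0) => /=; rewrite e1 ei ej eu acts_cat addnS.
  by rewrite acts_nseq_bS acts_Q.
Qed.

Lemma minmon_pow_inl u n (s : point) :
  ((inl u : minmon) ^+ n * inr s)%g = inr (iter n (acts u) s) :> minmon.
Proof. by elim: n => [|n IH]; rewrite ?mul1g // expgS -mulgA IH. Qed.

Lemma minmon_pow_inr (s : point) n :
  0 < n -> ((inr s : minmon) ^+ n)%g = inr s :> minmon.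
Proof. by case: n => // n _; rewrite expgS. Qed.

(** If [x] or [y] is a point, it absorbs what follows. Otherwise [z] is a point and the sequence is
    tame; its term at [n = 1] is [Q k], which rules out the two growing shapes. *)
Lemma minmon_pump (x y z : minmon) k : (x * y * z)%g = inr (Q k) :> minmon ->
  stationary (fun n => x * y ^+ n * z)%g.
Proof.
case: x => [v|s] e; last by exists 0.
case: y e => [u|s] e; last first.
  by exists 1 => n n0; rewrite !minmon_pow_inr.
case: z e => [w|s] //.
rewrite -mulgA => -[e].
have : tame (fun n => acts v (iter n (acts u) s)) by apply/tame_acts/tame_iter.
case=> [[l [r [j [l0 fE]]]]|[i [l [r [l0 fE]]]]|[N fE]].
- by have := fE 1 isT; rewrite /= e.
- by have := fE 1 isT; rewrite /= e.
- by exists N => n /fE en; rewrite -!mulgA !minmon_pow_inl; congr inr.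
Qed.

(** * Absence of a regular cross-section *)

Lemma word_value_cat (M : monoidType) (A : {fset M}) (u v : seq A) :
  word_value (u ++ v) = (word_value u * word_value v)%g.
Proof. exact: big_cat. Qed.

Lemma word_value_pow (M : monoidType) (A : {fset M}) (u : seq A) n :
  word_value (flatten (nseq n u)) = (word_value u ^+ n)%g.
Proof.
elim: n => [|n IH] /=; first by rewrite /word_value big_nil.
by rewrite word_value_cat IH expgS.
Qed.

Lemma pump_nil (T : Type) (x y z : seq T) n :
  x ++ flatten (nseq n.+1 y) ++ z = x ++ flatten (nseq n y) ++ z -> y = [::].
Proof.
by move/(congr1 size); rewrite /= !size_cat => e; apply: size0nil; lia.
Qed.

Lemma minmon_no_regular_cross_section : ~ has_regular_cross_section minmon.
Proof.
case=> A [L [_ [D DL] csL]].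
have repr k : exists w, dfa_accept D w && (word_value w == inr (Q k)).
  have [w [[/DL Lw wk] _]] := csL (inr (Q k)).
  by exists w; rewrite Lw; apply/eqP.
pose f k := xchoose (repr k).
have fP k : dfa_accept D (f k) /\ word_value (f k) = inr (Q k).
  by have /andP[? /eqP] := xchooseP (repr k).
(* The [Q k] are distinct, hence so are their representatives, and one of them is long enough to
   pump. *)
have f_inj : injective f.
  by move=> k l e; have [_] := fP k; rewrite e; have [_ ->] := fP l; case.
have [k /dfa_pump[x [y [z [ew y0 acc]]]]] := long_image #|dfa_state D| f_inj.
have [Dk] := fP k; rewrite ew !word_value_cat mulgA => /minmon_pump[N st].
pose w n := x ++ flatten (nseq n y) ++ z.
have Lw n : L (w n) by apply/DL; rewrite acc ew -ew.
have wE n :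
  word_value (w n) = (word_value x * word_value y ^+ n * word_value z)%g.
  by rewrite !word_value_cat word_value_pow mulgA.
have [v [_ uv]] := csL (word_value (w N)).
(* Both words lie in [L] and have the same value, so uniqueness identifies them although their
   lengths differ. *)
have eN : w N = w N.+1.
  by rewrite -(uv (w N)) // -(uv (w N.+1)) //; split; rewrite // !wE st.
exact/y0/(pump_nil (esym eN)).
Qed.

(** * Normal forms in the product with the integers *)

(** A copy of [int] whose multiplicatively written monoid law is addition. *)
Definition cyc := int.
HB.instance Definition _ := Choice.on cyc.
HB.instance Definition _ :=
  isMonoid.Build cyc (@addrA int) (@add0r int) (@addr0 int).

(* [Lt true] and [Lt false] stand for a generator of [cyc] and its inverse, and
   [Lh] for the base point [P 0 0]. *)
Inductive gen := Ly of letter | Lh | Lt of bool.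

Definition gen_encode (x : gen) : letter + option bool :=
  match x with Ly y => inl y | Lh => inr None | Lt b => inr (Some b) end.
Definition gen_decode (o : letter + option bool) : gen :=
  match o with inl y => Ly y | inr None => Lh | inr (Some b) => Lt b end.
Lemma gen_encodeK : cancel gen_encode gen_decode.
Proof. by case. Qed.
HB.instance Definition _ := Finite.copy gen (can_type gen_encodeK).

Definition weight (y : letter) : int :=
  match y with La => 1 | Lb => -1 | Ld => 0 end.

Definition gen_value (x : gen) : minmon * cyc :=
  match x with
  | Ly y => (inl [:: y], weight y)
  | Lh => (inr (P 0 0), 0%R)
  | Lt b => (inl [::], if b then 1%R else (-1)%R)
  end.

Lemma gen_value_inj : injective gen_value.
Proof. by case=> [[]||[]] [[]||[]]. Qed.

Definition value (w : seq gen) : minmon * cyc := (\prod_(x <- w) gen_value x)%g.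

Definition total_weight (u : seq letter) : int := (\sum_(y <- u) weight y)%R.

Definition tail (n : int) : seq gen :=
  match n with
  | Posz n => nseq n (Lt true)
  | Negz n => nseq n.+1 (Lt false)
  end.

Definition ab (i j : nat) := nseq i La ++ nseq j Lb.

(** The tail supplies the part of [n] that the letters do not. Over [Q k] there is no tail: as
    [p - q = n] and [p] or [q] is 0, the exponents have minimum [k] and difference [n]. *)
Definition normal_form (e : minmon * cyc) : seq gen :=
  match e with
  | (inl u, n) => map Ly u ++ tail (n - total_weight u)%R
  | (inr (inl (i, j)), n) =>
      map Ly (ab i j) ++ Lh :: tail (n - (i%:Z - j%:Z))%R
  | (inr (inr k), n) =>
      let (p, q) := match n with Posz n => (n, 0) | Negz n => (0, n.+1) end in
      map Ly (Ld :: ab (k + p) (k + q)) ++ [:: Lh]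
  end.

Lemma value_nil : value [::] = (1%g, 0%R).
Proof. exact: big_nil. Qed.

Lemma value_cat u v : value (u ++ v) = (value u * value v)%g.
Proof. exact: big_cat. Qed.

Lemma value_cons x v : value (x :: v) = (gen_value x * value v)%g.
Proof. exact: big_cons. Qed.

Lemma mul_pairE (x y : minmon) (m n : cyc) :
  ((x, m) * (y, n))%g = ((x * y)%g, (m + n)%R) :> minmon * cyc.
Proof. by []. Qed.

Lemma value_letters u : value (map Ly u) = (inl u, total_weight u).
Proof.
elim: u => [|y u IH]; first by rewrite /value /total_weight !big_nil.
by rewrite /= value_cons IH mul_pairE /total_weight big_cons.
Qed.

Lemma value_tail n : value (tail n) = (1%g, n).
Proof.
have nseqt b m : value (nseq m (Lt b)) = (1%g, (if b then m%:Z else - m%:Z)%R).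
  elim: m => [|m IH] /=; first by rewrite /value big_nil; case: b.
  by rewrite value_cons IH mul_pairE; congr pair; case: b {IH}; lia.
case: n => n; rewrite /tail nseqt //; congr pair; lia.
Qed.

Lemma total_weight_ab i j : total_weight (ab i j) = (i%:Z - j%:Z)%R.
Proof.
rewrite /total_weight big_cat !big_nseq /= !iter_addr_0 /=.
by rewrite mulNrn !natz.
Qed.

Lemma acts_ab i j : acts (ab i j) (P 0 0) = P i j.
Proof. by rewrite acts_cat acts_nseq_b acts_nseq_a !addn0. Qed.

(** The base point is a left zero, so what follows [Lh] contributes only its second component. *)
Lemma value_base i j v :
  value (map Ly (ab i j) ++ Lh :: v) =
    (inr (P i j), (i%:Z - j%:Z + (value v).2)%R).
Proof.
rewrite value_cat value_letters value_cons /=.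
case: (value v) => x n; rewrite mul_pairE total_weight_ab; congr pair.
  by congr inr; rewrite acts_ab.
by congr (_ + _)%R; exact: add0r.
Qed.

Lemma value_quotient i j :
  value (map Ly (Ld :: ab i j) ++ [:: Lh]) =
    (inr (Q (minn i j)), (i%:Z - j%:Z)%R).
Proof.
rewrite [X in value X]/= value_cons value_base value_nil mul_pairE; congr pair.
by rewrite /= add0r addr0.
Qed.

Lemma normal_formK : cancel normal_form value.
Proof.
case=> [[u|[[i j]|k]] n].
- rewrite /normal_form value_cat value_letters value_tail mul_pairE mulg1.
  by rewrite addrC subrK.
- by rewrite /normal_form value_base value_tail /= addrC subrK.
- rewrite /normal_form; case: n => n; rewrite value_quotient.
    by congr pair; [congr (inr (Q _)) |]; lia.
  by congr pair; [congr (inr (Q _)) |]; lia.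
Qed.

(** * An automaton for the normal forms *)

(* [Word d b] is reached after Ld^d La^i Lb^j with [j > 0] iff [b], [Hash d]
   after the same followed by [Lh], and [Tail b] inside a power of [Lt b]. *)
Inductive state :=
  Start | Word of bool & bool | Other | Hash of bool | Tail of bool.

Definition state_encode (s : state) :
    option (option (bool + (bool + bool * bool))) :=
  match s with
  | Start => None | Other => Some None
  | Hash d => Some (Some (inl d)) | Tail b => Some (Some (inr (inl b)))
  | Word d b => Some (Some (inr (inr (d, b))))
  end.
Definition state_decode (o : option (option (bool + (bool + bool * bool)))) :=
  match o with
  | None => Start | Some None => Other
  | Some (Some (inl d)) => Hash d | Some (Some (inr (inl b))) => Tail b
  | Some (Some (inr (inr (d, b)))) => Word d b
  end.
Lemma state_encodeK : cancel state_encode state_decode.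
Proof. by case. Qed.
HB.instance Definition _ := Finite.copy state (can_type state_encodeK).

(** Refusals secure uniqueness: [Other] refuses [Lh], [Hash true] refuses any tail, and a tail
    cannot change sign. *)
Definition read (s : state) (x : gen) : option state :=
  match s, x with
  | Start, Ly La => Some (Word false false)
  | Start, Ly Lb => Some (Word false true)
  | Start, Ly Ld => Some (Word true false)
  | Start, Lh => Some (Hash false)
  | Word d false, Ly La => Some (Word d false)
  | Word d _, Ly Lb => Some (Word d true)
  | Word _ _, Ly _ => Some Other
  | Word d _, Lh => Some (Hash d)
  | Other, Ly _ => Some Other
  | Hash true, Lt _ => None
  | Start, Lt b | Word _ _, Lt b | Other, Lt b | Hash false, Lt b =>
    Some (Tail b)
  | Tail b, Lt c => if b == c then Some (Tail b) else None
  | _, _ => None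
  end.

Definition accepted (w : seq gen) : Prop := prun read Start w.

Definition letters_state (s : state) :=
  match s with Start | Word _ _ | Other => true | _ => false end.

Lemma prun_letters u : exists2 s, prun read Start (map Ly u) = Some s
  & letters_state s.
Proof.
elim/last_ind: u => [|u y [s e ls]]; first by exists Start.
rewrite map_rcons prun_rcons e /=.
case: s ls {e} => [|d b||b|b] // _; case: y; try case: b; eexists; by [].
Qed.

Lemma prun_nseq s x n : read s x = Some s -> prun read s (nseq n x) = Some s.
Proof. by move=> e; elim: n => //= n IH; rewrite prun_cons e. Qed.

Lemma prun_tail s n : letters_state s \/ s = Hash false -> prun read s (tail n).
Proof.
have nt b m : letters_state s \/ s = Hash false -> prun read s (nseq m (Lt b)).
  case: m => // m hs; rewrite prun_cons.
  have -> : read s (Lt b) = Some (Tail b).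
    by case: s hs => [|d []||[]|c] [].
  by rewrite /= prun_nseq //= eqxx.
by case: n => n; apply: nt.
Qed.

Lemma prun_ab d i j :
  exists b, prun read (Word d false) (map Ly (ab i j)) = Some (Word d b).
Proof.
rewrite /ab map_cat !map_nseq prun_cat prun_nseq //=.
case: j => [|j]; first by exists false.
by exists true; rewrite prun_cons /= prun_nseq.
Qed.

Lemma prun_base i j :
  prun read Start (map Ly (ab i j) ++ [:: Lh]) = Some (Hash false).
Proof.
(* The word of letters may be empty or begin with [La] or [Lb], and each case leaves [Start]
   differently. *)
rewrite prun_cat; case: i => [|i].
  rewrite /ab map_cat !map_nseq; case: j => // j.
  by rewrite prun_cons /= prun_nseq.
have -> : map Ly (ab i.+1 j) = Ly La :: map Ly (ab i j) by [].
rewrite prun_cons /=.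
by have [[] ->] := prun_ab false i j.
Qed.

Lemma normal_form_accepted e : accepted (normal_form e).
Proof.
rewrite /accepted; case: e => [[u|[[i j]|k]] n] /=.
- rewrite prun_cat; have [s -> ls] /= := prun_letters u.
  by apply: prun_tail; left.
- by rewrite -cat1s catA prun_cat prun_base; apply: prun_tail; right.
(* The automaton does not count, so arbitrary [p] and [q] will do. *)
- case: (match n with Posz n => (n, 0) | Negz n => (0, n.+1) end) => p q.
  rewrite prun_cons /= prun_cat.
  by have [[] ->] := prun_ab true (k + p) (k + q).
Qed.

(** * Accepted words are normal forms *)

(** An invariant of runs ending in [s], stated only as a necessary condition on [w]. *)
Definition shape (s : state) (w : seq gen) : Prop :=
  match s with
  | Start => w = [::]
  | Word d b =>
      exists i j, w = map Ly (nseq d Ld ++ ab i j) /\ (b || (j == 0))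
  | Other => exists u, w = map Ly u
  | Hash d => exists i j, w = map Ly (nseq d Ld ++ ab i j) ++ [:: Lh]
  | Tail b => exists v n, w = v ++ nseq n.+1 (Lt b) /\
      ((exists u, v = map Ly u) \/ (exists i j, v = map Ly (ab i j) ++ [:: Lh]))
  end.

Lemma rcons_nseq (T : Type) n (x : T) : rcons (nseq n x) x = nseq n.+1 x.
Proof. by rewrite -addn1 nseqD cats1. Qed.

Lemma ab_rcons_a i : rcons (ab i 0) La = ab i.+1 0.
Proof. by rewrite /ab !cats0 rcons_nseq. Qed.

Lemma ab_rcons_b i j : rcons (ab i j) Lb = ab i j.+1.
Proof. by rewrite /ab rcons_cat rcons_nseq. Qed.

Lemma accepted_shape s w : prun read Start w = Some s -> shape s w.
Proof.
elim/last_ind: w s => [|w x IH] s; first by case=> <-.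
rewrite prun_rcons; case: (prun read Start w) IH => //= t /(_ _ erefl).
have rmap u y : rcons (map Ly u) (Ly y) = map Ly (rcons u y).
  by rewrite map_rcons.
case: t => [|d b||d|b] /=.
- move=> ->; case: x => [[]||b] //= [<-] /=.
  + by exists 1, 0.
  + by exists 0, 1.
  + by exists 0, 0.
  + by exists 0, 0.
  + by exists [::], 0; split=> //; left; exists [::].
- case=> i [j [-> jb]].
  have to_other y : shape Other (rcons (map Ly (nseq d Ld ++ ab i j)) (Ly y)).
    by rewrite rmap; eexists.
  have to_b :
      shape (Word d true) (rcons (map Ly (nseq d Ld ++ ab i j)) (Ly Lb)).
    by exists i, j.+1; rewrite rmap rcons_cat ab_rcons_b.
  have to_hash : shape (Hash d) (rcons (map Ly (nseq d Ld ++ ab i j)) Lh).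
    by exists i, j; rewrite cats1.
  have to_tail c : shape (Tail c) (rcons (map Ly (nseq d Ld ++ ab i j)) (Lt c)).
    by eexists; exists 0; rewrite cats1; split=> //; left; eexists.
  (* What remains is [La] read in [Word d false]: there [j = 0], so it extends the block of
     [La]s. *)
  case: b jb => [_|/eqP j0]; case: x => [[]||c] //= [<-] //.
  by exists i.+1, 0; rewrite rmap rcons_cat j0 ab_rcons_a.
- case=> u ->; case: x => [y||b] //= [<-] /=.
  + by rewrite rmap; eexists.
  + by exists (map Ly u), 0; rewrite cats1; split=> //; left; exists u.
- case: d => -[i [j ->]]; case: x => [y||b] //= [<-] /=.
  exists (map Ly (ab i j) ++ [:: Lh]), 0; split; first by rewrite -!cats1.
  by right; exists i, j.
- case=> v [n [-> h]]; case: x => [y||c] //=; case: eqP => // <- [<-] /=.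
  by exists v, n.+1; split=> //; rewrite rcons_cat (rcons_nseq n.+1).
Qed.

Lemma normal_form_letters u n : exists e, map Ly u ++ tail n = normal_form e.
Proof.
by exists (inl u, (n + total_weight u)%R); rewrite /normal_form addrK.
Qed.

Lemma normal_form_base i j n :
  exists e, map Ly (ab i j) ++ Lh :: tail n = normal_form e.
Proof.
by exists (inr (inl (i, j)), (n + (i%:Z - j%:Z))%R); rewrite /normal_form addrK.
Qed.

Lemma normal_form_quotient i j :
  exists e, map Ly (Ld :: ab i j) ++ [:: Lh] = normal_form e.
Proof.
(* The sign of [i - j] tells which exponent is the minimum, so both can be recovered. *)
exists (inr (inr (minn i j)), (i%:Z - j%:Z)%R).
rewrite /normal_form; case e: (i%:Z - j%:Z)%R => [n|n].
  by congr (map Ly (Ld :: ab _ _) ++ _); lia.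
by congr (map Ly (Ld :: ab _ _) ++ _); lia.
Qed.

Lemma tail_nseq b n : exists m, nseq n (Lt b) = tail m.
Proof.
case: b; first by exists (Posz n).
by case: n => [|n]; [exists (Posz 0) | exists (Negz n)].
Qed.

Lemma accepted_normal_form w : accepted w -> exists e, w = normal_form e.
Proof.
rewrite /accepted; case e: prun => [s|] // _.
(* Words of letters alone are treated as having the trivial tail. *)
have tail0 v : v = v ++ tail 0 by rewrite cats0.
have := accepted_shape e; case: s {e} => [|d b||[]|b] /=.
- by move=> ->; exact: (normal_form_letters [::] 0).
- by case=> i [j [-> _]]; rewrite (tail0 (map _ _)); exact: normal_form_letters.
- by case=> u ->; rewrite (tail0 (map _ _)); exact: normal_form_letters.
- by case=> i [j ->]; exact: normal_form_quotient.
- by case=> i [j ->]; exact: (normal_form_base i j 0).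
- case=> v [n [-> h]]; rewrite -[Lt b :: _]/(nseq n.+1 (Lt b)).
  have [m ->] := tail_nseq b n.+1.
  case: h => [[u ->]|[i [j ->]]]; first exact: normal_form_letters.
  by rewrite -catA; exact: normal_form_base.
Qed.

(** * The counterexample to both closure properties *)

(** The accepted words are exactly the normal forms, and [value] inverts [normal_form]. *)
Lemma minmon_cyc_Markov : Markov_monoid (minmon * cyc)%type.
Proof.
apply: (Markov_of_letters gen_value_inj (L := accepted)).
- exact: prun_prefix_closed.
- exact: prun_regular.
- move=> e; exists (normal_form e); split.
    by split; [exact: normal_form_accepted | exact: normal_formK].
  move=> w [/accepted_normal_form[e' ->]].
  by rewrite -/(value _) normal_formK => ->.
Qed.

Theorem theorem3p3 :
  ~ closed_under_direct_factors has_regular_cross_section /\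
  ~ closed_under_direct_factors Markov_monoid.
Proof.
(* The product lies in both classes, while either closure would give [minmon] a regular
   cross-section. *)
split=> closedF; apply: minmon_no_regular_cross_section.
  by case: (closedF _ _ (Markov_regular_cross_section minmon_cyc_Markov)).
by apply: Markov_regular_cross_section; case: (closedF _ _ minmon_cyc_Markov).
Qed.
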